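(* Every finite group $G$ can be generated by $dl(G)$ elements, where $dl(G)$ is the distributive length of $G$.
   Context: For finite groups $H\subseteq K$, $[H,K]$ denotes the lattice of subgroups $L$ with $H\subseteq L\subseteq K$. The distributive length $dl(G)$ is the minimal length $n$ of an ordered chain of subgroups $\{1\}=H_0\subset H_1\subset\dots\subset H_n=G$ such that for each $i$ the interval $[H_i,H_{i+1}]$ is a distributive lattice. *)

(* Defs.v *)
From mathcomp Require Import all_boot all_fingroup all_solvable.
Set Implicit Arguments.
Unset Strict Implicit.
Unset Printing Implicit Defensive.
Import GroupScope.

Section DistributiveLength.

Variable gT : finGroupType.
Implicit Types G H K L : {group gT}.

Definition in_interval H K L := (H \subset L) && (L \subset K).

(* Meets and joins in [H, K] are those of the full subgroup lattice: [:&:] and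
   [<*>]. The law is the one of [distrLatticeType] ([left_distributive]). *)
Definition distributive_interval H K :=
  [forall L1 : {group gT}, forall L2 : {group gT}, forall L3 : {group gT},
     [&& in_interval H K L1, in_interval H K L2 & in_interval H K L3] ==>
     ((L1 <*> L2) :&: L3 == (L1 :&: L3) <*> (L2 :&: L3))].

(* The sequence [H_1; ...; H_n] encodes the chain 1 = H_0 < H_1 < ... < H_n = G. *)
Definition distributive_chain G (s : seq {group gT}) :=
  path [rel H K : {group gT} | (H \proper K) && distributive_interval H K]
       1%G s
  && (last 1%G s == G).

Definition has_distributive_chain G n :=
  [exists s : n.-tuple {group gT}, distributive_chain G s].

Lemma distributive_interval_maximal H K :
  maximal H K -> distributive_interval H K.
Proof.
move=> maxH; have /maxgroupP[/proper_sub sHK maxHP] := maxH.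
have two L : in_interval H K L -> L = H \/ L = K.
  case/andP=> sHL sLK; have [-> | neLK] := eqVneq L K; first by right.
  left; apply/val_inj/maxHP => //; rewrite properEneq sLK andbT.
  by apply: contra neLK => /eqP eLK; apply/eqP/val_inj.
have jHK : H <*> K = K by apply/joing_idPr.
have jKH : K <*> H = K by apply/joing_idPl.
have jj (M : {group gT}) : M <*> M = M by rewrite joingE setUid genGid.
have iHK : H :&: K = H by apply/setIidPl.
have iKH : K :&: H = H by apply/setIidPr.
apply/forallP=> L1; apply/forallP=> L2; apply/forallP=> L3.
apply/implyP=> /and3P[/two[]-> /two[]-> /two[]->];
  by rewrite ?(jHK, jKH, jj, iHK, iKH, setIid).
Qed.

Lemma distributive_chain_exists G : exists n, has_distributive_chain G n.
Proof.
have [m] := ubnP #|G|; elim: m G => // m IHm G leGm.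
have [/eqP G1 | ntG] := boolP (G :==: 1).
  exists 0; apply/existsP; exists [tuple]; rewrite /distributive_chain /=.
  by apply/eqP/val_inj.
have [M maxM _] : {M : {group gT} | maximal M G & [1 gT] \subset M}.
  by apply: maxgroup_exists; rewrite proper1G.
have ltMG : M \proper G by case/maxgroupP: maxM.
have [|n /existsP[s /andP[ps /eqP ls]]] := IHm M.
  exact: leq_trans (proper_card ltMG) leGm.
exists n.+1; apply/existsP; exists [tuple of rcons s G].
rewrite /distributive_chain rcons_path last_rcons ls ps eqxx /= ltMG.
by rewrite distributive_interval_maximal.
Qed.

Definition dl G : nat := ex_minn (distributive_chain_exists G).

End DistributiveLength.

(* Main.v *)
Require Import Defs.
From mathcomp Require Import all_boot all_fingroup all_solvable.
Import GroupScope.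

(** The bound is one generator per step of a distributive chain, and rests on
    a theorem of Ore: if the interval [[H, K]] is distributive, then
    [K = <H, g>] for some [g].  For [H] trivial this is the classical
    fact that a finite group with a distributive subgroup lattice is cyclic.

    Ore's theorem is proved by induction on [#|K|].  If [H] is proper in [K],
    take a maximal subgroup [M] of [K] above [H]; by induction [M = <H, a>].
    Among the elements of [K] outside [M], take [b] such that [A = <H, b>] is
    smallest; thus every proper subgroup of [A] above [H] lies in [M].
    The claim is that [g = a b] works.  Put [L = <H, g>].  As [M] contains [a]
    but not [b], it does not contain [g], so [M] and [L] generate [K], and
    distributivity gives
      [A = (M <*> L) :&: A = (M :&: A) <*> (L :&: A)].
    As [A] is not inside [M], neither is [L :&: A], so that [L :&: A = A] by the
    choice of [b].  Then [L] contains [b], hence [a], hence [M], and [L = K].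

    Applying this to the successive intervals of a distributive chain of
    minimal length yields [dl G] generators of [G]. *)

Section Ore.

Variable gT : finGroupType.
Implicit Types (H K L M : {group gT}) (s : seq {group gT}).

Lemma distributive_intervalS H K M :
  M \subset K -> distributive_interval H K -> distributive_interval H M.
Proof.
move=> sMK /forallP dK; apply/forallP=> L1; apply/forallP=> L2.
apply/forallP=> L3; apply/implyP=> /and3P[/andP[H1 M1] /andP[H2 M2] /andP[H3 M3]].
move/forallP/(_ L2)/forallP/(_ L3)/implyP: (dK L1); apply.
by rewrite /in_interval H1 H2 H3 !(subset_trans _ sMK).
Qed.

(** Ore's theorem.  The induction keeps [H] fixed and shrinks [K], because
    distributivity is inherited by the lower intervals [[H, M]]. *)
Lemma distributive_interval_cyclic_ext H K :
    H \subset K -> distributive_interval H K ->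
  exists g, H <*> <[g]> = K.
Proof.
have [m] := ubnP #|K|; elim: m K => // m IHm K leKm sHK dHK.
have [-> | [M maxM sHM]] := maximal_exists sHK.
  by exists 1; rewrite cycle1 joingG1.
have ltMK := maxgroupp maxM; have sMK := proper_sub ltMK.
have [a defM]: exists a, H <*> <[a]> = M.
  apply: IHm => //; last exact: distributive_intervalS dHK.
  exact: leq_trans (proper_card ltMK) leKm.
have Ma : a \in M by rewrite -defM mem_gen // inE cycle_id orbT.
have [b0 Kb0 Mb0] : exists2 b, b \in K & b \notin M.
  by case/properP: ltMK => _ [b Kb Mb]; exists b.
case: (@arg_minnP _ b0 [pred b | (b \in K) && (b \notin M)]
         (fun b => #|H <*> <[b]>|)) => [|b /andP[Kb Mb] minb].
  by rewrite /= Kb0.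
set A := H <*> <[b]> in minb; exists (a * b); set L := H <*> <[a * b]>.
have Ka := subsetP sMK a Ma.
have sAK : A \subset K by rewrite join_subG sHK cycle_subG.
have sLK : L \subset K by rewrite join_subG sHK cycle_subG groupM.
have Ab : b \in A by rewrite mem_gen // inE cycle_id orbT.
have Lab : a * b \in L by rewrite mem_gen // inE cycle_id orbT.
have sHA : H \subset A := joing_subl _ _.
have sHL : H \subset L := joing_subl _ _.
have genK (X : {group gT}) : X \subset K -> M \subset X -> b \in X ->
    X = K :> {set gT}.
  move=> sXK sMX Xb; apply/eqP; rewrite eqEproper sXK /=.
  apply: contra Mb => ltXK.
  by case/maxgroupP: maxM => _ /(_ X ltXK sMX) <-.
have joinML : M <*> L = K.
  apply: (genK (M <*> L)%G); [by rewrite join_subG sMK | exact: joing_subl |].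
  have MLa : a \in (M <*> L)%G := subsetP (joing_subl M L) a Ma.
  rewrite -(groupMl b MLa).
  exact: (subsetP (joing_subr M L)).
have splitA : A = (M :&: A) <*> (L :&: A).
  have /forallP/(_ M)/forallP/(_ L%G)/forallP/(_ A%G)/implyP := dHK.
  rewrite /in_interval sHM sMK sHL sLK sHA sAK => /(_ isT)/eqP <-.
  by rewrite /= joinML (setIidPr sAK).
have [c /setIP[Lc Ac] Mc] : exists2 c, c \in L :&: A & c \notin M.
  apply/subsetPn; apply: contra Mb => sLAM.
  have: A \subset M by rewrite splitA join_subG subsetIl.
  by move/subsetP; apply.
(* [<H, c>] lies in [A] and, by minimality of [b], is no smaller than [A]. *)
have defA : H <*> <[c]> = A.
  apply/eqP; rewrite eqEcard join_subG sHA cycle_subG Ac /=.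
  by apply: minb; rewrite /= (subsetP sAK) ?Mc.
have sAL : A \subset L by rewrite -defA join_subG sHL cycle_subG.
have Lb := subsetP sAL b Ab.
have La : a \in L by rewrite -(groupMr a Lb).
by apply: genK => //; rewrite -defM join_subG sHL cycle_subG.
Qed.

(** Each step [H_i < H_i.+1] of the chain costs one generator, by Ore's
    theorem.  The starting group is arbitrary so that the induction can peel
    off the first step. *)
Lemma distributive_path_generators H s :
    path [rel H K : {group gT} | (H \proper K) && distributive_interval H K]
      H s ->
  exists t : (size s).-tuple gT, H <*> <<[set x in t]>> = last H s.
Proof.
elim: s H => [|K s IHs] H /=.
  exists [tuple]; apply/joing_idPl; rewrite gen_subG.
  by apply/subsetP=> x; rewrite inE.
case/andP=> /andP[/proper_sub sHK dHK] /IHs[t <-].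
have [g <-] := distributive_interval_cyclic_ext _ _ sHK dHK.
exists [tuple of g :: t]; rewrite set_cons -joingA; congr (_ <*> _).
by rewrite joing_idl joing_idr.
Qed.

End Ore.

Theorem corollary7p34 (gT : finGroupType) (G : {group gT}) :
  exists s : (dl G).-tuple gT, <<[set x in s]>> = G :> {set gT}.
Proof.
rewrite /dl; case: ex_minnP => n /existsP[s /andP[chain_s /eqP last_s]] _.
have := distributive_path_generators _ _ _ chain_s.
by rewrite size_tuple last_s => -[t]; rewrite joing1G; exists t.
Qed.
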